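(* Let $P\subset\mathbb{C}$ be an open half-plane such that $0\notin\overline{P}$, and write points as $x+iy$ with $x,y\in\mathbb{R}$. (1) If $P$ is described either by $y>ax+b$ with $a,b\in\mathbb{R}$, $b>0$, or by $y<ax+b$ with $a,b\in\mathbb{R}$, $b<0$, then $$\iota(P) = B\left(\frac{-a}{2b} + i\,\frac{-1}{2b},\ \frac{\sqrt{a^2+1}}{2|b|}\right).$$ (2) If $P$ is described either by $x>c$ with $c>0$, or by $x<c$ with $c<0$, then $$\iota(P) = B\left(\frac{1}{2c},\ \frac{1}{2|c|}\right).$$
   Context: $\overline{\mathbb{C}}=\mathbb{C}\cup\{\infty\}$ is the Riemann sphere and $\iota:\overline{\mathbb{C}}\to\overline{\mathbb{C}}$ is the inversion $\iota(z)=z^{-1}$ with $\iota(0)=\infty$ and $\iota(\infty)=0$. $B(w,r)=\{z\in\mathbb{C}:|z-w|<r\}$ is the open ball; $\overline{P}$ is the closure of $P$. *)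

(* Defs.v *)
(* MathComp-Analysis, with the complex numbers R[i] of mathcomp-real-closed. *)
From mathcomp Require Import all_boot all_order all_algebra.
From mathcomp Require Import all_classical all_reals all_analysis.
From mathcomp Require Import complex.

Set Implicit Arguments.
Unset Strict Implicit.
Unset Printing Implicit Defensive.

Import Order.TTheory GRing.Theory Num.Theory.
Import numFieldNormedType.Exports.

Local Open Scope classical_set_scope.
Local Open Scope ring_scope.

(* R[i] is used through the alias R[i]^o, on which the topology induced by the
   modulus is found by inference.  As [`|z|] lives in R[i], the radius of a
   [ball] is also an element of R[i], namely [r%:C] for a real r. *)
Definition riemann_sphere (R : realType) : Type :=
  one_point_compactification R[i]^o.

Definition infty_sphere {R : realType} : riemann_sphere R := None.

Definition to_sphere {R : realType} (z : R[i]^o) : riemann_sphere R := Some z.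

Definition inversion {R : realType} (w : riemann_sphere R) : riemann_sphere R :=
  match w with
  | Some z => if z == 0 then infty_sphere else to_sphere z^-1
  | None => to_sphere 0
  end.

Definition open_half_plane {R : realType} (P : set R[i]^o) : Prop :=
  exists a b c : R, (a, b) <> (0, 0) /\
    P = [set z : R[i]^o | c < a * complex.Re z + b * complex.Im z].

(* Main.v *)
(** For [0 < c], writing [z = 1 / w] with [w = x + i y] turns the half-plane
    condition [c < p Re z + q Im z] into [c |w|^2 < p x - q y], and completing
    the square gives a disc.  Neither the half-plane nor the disc contains [0],
    so the point at infinity plays no role. *)
Require Import Defs.
From mathcomp Require Import all_boot all_order all_algebra.
From mathcomp Require Import all_classical all_reals all_analysis.
From mathcomp Require Import complex.
From mathcomp Require Import ring lra.
Import Order.TTheory GRing.Theory Num.Theory.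
Import numFieldNormedType.Exports.
Local Open Scope classical_set_scope.
Local Open Scope ring_scope.
Local Open Scope complex_scope.

(** Away from [0], [inversion] is the involution [z^-1], so one equivalence yields both inclusions.
    Keeping [0] out of both sets excludes the branches that involve [infty_sphere]. *)
Lemma inversion_image (R : realType) (A B : set R[i]^o) :
  ~ A 0 -> ~ B 0 -> (forall z : R[i]^o, z != 0 -> A z <-> B z^-1) ->
  inversion @` (to_sphere @` A) = to_sphere @` B.
Proof.
move=> A0 B0 AB; apply/seteqP; split.
- move=> _ [_ [z Az <-] <-].
  have z0 : z != 0 by apply/eqP => z0; apply: A0; rewrite -z0.
  exists z^-1; first exact/AB.
  by rewrite /= (negbTE z0).
- move=> _ [w Bw <-].
  have w0 : w != 0 by apply/eqP => w0; apply: B0; rewrite -w0.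
  have Aw : A w^-1 by apply/AB; rewrite ?invr_eq0 // invrK.
  exists (to_sphere w^-1); first by exists w^-1.
  by rewrite /= invr_eq0 (negbTE w0) invrK.
Qed.

(** Squaring preserves the strict order between nonnegative reals, which removes the square root in
    the modulus. *)
Lemma ball_complexE (R : realType) (u v r x y : R) : 0 <= r ->
  ball ((u +i* v) : R[i]^o) r%:C (x +i* y) <->
  (u - x) ^+ 2 + (v - y) ^+ 2 < r ^+ 2.
Proof.
move=> r0; rewrite -ball_normE /ball_ /= normc_def ltcR /=.
rewrite -(@ltr_pXn2r _ 2) ?nnegrE ?sqrtr_ge0 // sqr_sqrtr //.
by rewrite addr_ge0 ?sqr_ge0.
Qed.

(** This normal form serves all four cases of the theorem: the normal [(p, q)] is [(-a, 1)],
    [(a, -1)], [(1, 0)] or [(-1, 0)]. *)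
Lemma inversion_half_plane (R : realType) (p q c : R) : 0 < c ->
  inversion @` (to_sphere @`
    [set z : R[i]^o | c < p * complex.Re z + q * complex.Im z]) =
  to_sphere @` ball ((p / (2 * c) +i* (- q / (2 * c))) : R[i]^o)
                    (Num.sqrt (p ^+ 2 + q ^+ 2) / (2 * c))%:C.
Proof.
move=> c0; have c2 : 0 < 2 * c by rewrite mulr_gt0.
have r0 : 0 <= Num.sqrt (p ^+ 2 + q ^+ 2) / (2 * c).
  by rewrite divr_ge0 ?sqrtr_ge0 // ltW.
have r2 : (Num.sqrt (p ^+ 2 + q ^+ 2) / (2 * c)) ^+ 2 =
          (p ^+ 2 + q ^+ 2) / (2 * c) ^+ 2.
  by rewrite expr_div_n sqr_sqrtr // addr_ge0 ?sqr_ge0.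
(* The circle bounding the disc passes through [0]. *)
have ballE x y : ball ((p / (2 * c) +i* (- q / (2 * c))) : R[i]^o)
    (Num.sqrt (p ^+ 2 + q ^+ 2) / (2 * c))%:C (x +i* y) <->
    c * (x ^+ 2 + y ^+ 2) < p * x - q * y.
  rewrite ball_complexE // r2 -subr_lt0 -[_ < p * x - q * y]subr_lt0.
  (* The squared modulus of the centre equals the squared radius, so the constant terms cancel; the
     remaining factor [c^-1] is positive. *)
  have -> : (p / (2 * c) - x) ^+ 2 + (- q / (2 * c) - y) ^+ 2 -
    (p ^+ 2 + q ^+ 2) / (2 * c) ^+ 2 =
    c^-1 * (c * (x ^+ 2 + y ^+ 2) - (p * x - q * y)).
    by field; rewrite gt_eqF.
  by rewrite pmulr_rlt0 // invr_gt0.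
apply: inversion_image.
- by rewrite /= !mulr0 addr0 => /(lt_trans c0); rewrite ltxx.
- by rewrite ballE expr0n /= !mulr0 addr0 subr0 mulr0 ltxx.
case=> x y z0.
have n0 : 0 < x ^+ 2 + y ^+ 2.
  rewrite lt_neqAle addr_ge0 ?sqr_ge0 // andbT eq_sym.
  rewrite paddr_eq0 ?sqr_ge0 // !sqrf_eq0.
  by apply: contra z0; rewrite eq_complex.
(* Since [z^-1] is the conjugate of [z] over its squared modulus, the disc condition at [z^-1] is
   the half-plane condition at [z] divided by [x ^+ 2 + y ^+ 2]. *)
rewrite ballE /=.
have -> : c * ((x / (x ^+ 2 + y ^+ 2)) ^+ 2 +
     (- (y / (x ^+ 2 + y ^+ 2))) ^+ 2) = c / (x ^+ 2 + y ^+ 2).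
  by field; rewrite gt_eqF.
have -> : p * (x / (x ^+ 2 + y ^+ 2)) - q * (- (y / (x ^+ 2 + y ^+ 2))) =
  (p * x + q * y) / (x ^+ 2 + y ^+ 2).
  by field; rewrite gt_eqF.
by rewrite ltr_pM2r // invr_gt0.
Qed.

Theorem theorem9 (R : realType) (P : set R[i]^o)
  (hP : open_half_plane P) (h0 : ~ closure P 0) :
  (forall a b : R,
     (0 < b /\ P = [set z : R[i]^o | complex.Im z > a * complex.Re z + b]) \/
     (b < 0 /\ P = [set z : R[i]^o | complex.Im z < a * complex.Re z + b]) ->
     inversion @` (to_sphere @` P) =
     to_sphere @` ball (((- a / (2 * b)) +i* (-1 / (2 * b))) : R[i]^o)
                       (Num.sqrt (a ^+ 2 + 1) / (2 * `|b|))%:C) /\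
  (forall c : R,
     (0 < c /\ P = [set z : R[i]^o | complex.Re z > c]) \/
     (c < 0 /\ P = [set z : R[i]^o | complex.Re z < c]) ->
     inversion @` (to_sphere @` P) =
     to_sphere @` ball ((1 / (2 * c))%:C : R[i]^o) (1 / (2 * `|c|))%:C).
Proof.
split=> [a b [[b0 ->]|[b0 ->]]|c [[c0 ->]|[c0 ->]]].
- have -> : [set z : R[i]^o | complex.Im z > a * complex.Re z + b] =
      [set z : R[i]^o | b < - a * complex.Re z + 1 * complex.Im z].
    by apply/seteqP; split=> z /=; lra.
  by rewrite inversion_half_plane // sqrrN expr1n gtr0_norm.
(* Negating the inequality makes the constant [- b] positive. The sign changes cancel in the centre,
   and [- b] is the absolute value of [b] in the radius. *)
- have -> : [set z : R[i]^o | complex.Im z < a * complex.Re z + b] =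
      [set z : R[i]^o | - b < a * complex.Re z + (-1) * complex.Im z].
    by apply/seteqP; split=> z /=; lra.
  have nb0 : 0 < - b by rewrite oppr_gt0.
  rewrite (inversion_half_plane _ _ _ _ nb0) (sqrrN 1) expr1n (ltr0_norm b0).
  have -> : a / (2 * - b) = - a / (2 * b) by rewrite mulrN invrN mulrN mulNr.
  by have -> : - -1 / (2 * - b) = -1 / (2 * b) by rewrite mulrN invrN mulrNN.
- have -> : [set z : R[i]^o | complex.Re z > c] =
      [set z : R[i]^o | c < 1 * complex.Re z + 0 * complex.Im z].
    by apply/seteqP; split=> z /=; lra.
  rewrite (inversion_half_plane _ _ _ _ c0) expr1n expr0n addr0.
  (* As [q = 0], the centre has imaginary part [0] and is thus the embedded real number. *)
  by rewrite sqrtr1 (gtr0_norm c0) oppr0 mul0r.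
- have -> : [set z : R[i]^o | complex.Re z < c] =
      [set z : R[i]^o | - c < -1 * complex.Re z + 0 * complex.Im z].
    by apply/seteqP; split=> z /=; lra.
  have nc0 : 0 < - c by rewrite oppr_gt0.
  rewrite (inversion_half_plane _ _ _ _ nc0) (sqrrN 1) expr1n expr0n addr0.
  rewrite sqrtr1 (ltr0_norm c0) oppr0 mul0r.
  by have -> : -1 / (2 * - c) = 1 / (2 * c) by rewrite mulrN invrN mulrNN.
Qed.
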